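(* Let $S=(S_{ij})_{i,j\ge 0}$ be the infinite lower-triangular matrix with $S_{ij}=\binom{i}{j}\bmod 2\in\{0,1\}$. For nonnegative integers $i,j$, say $i$ is free of $j$ if the binary expansion of $i$ has 0s in all positions where that of $j$ has 1s, and let $b(n)$ denote the sum of the binary digits of $n$. For a number $x$, let $S(x)$ be the infinite lower-triangular matrix with $S(x)_{ij}=x^{b(i-j)}$ if $i\ge j\ge 0$ and $i-j$ is free of $j$, and $S(x)_{ij}=0$ otherwise (so $S(1)=S$). Then for every rational number $r$, $S^{r}=S(r)$; that is, for all integers $p$ and positive integers $q$ with $r=p/q$, one has $S(p/q)^{q}=S^{p}$ (where for $p<0$, $S^p$ means $(S^{-1})^{-p}$). In particular $S^{-1}=S(-1)$ and $S^0=I=S(0)$.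
   Context: Infinite lower-triangular matrices are multiplied in the usual way (each entry of a product is a finite sum); $S$ is lower unitriangular and hence invertible. Convention: $0^0=1$, so $S(0)$ is the identity matrix. *)

(* Defs.v *)
(* boolp supplies functional extensionality and choice for the type of infinite
   lower-triangular matrices. *)
From HB Require Import structures.
From mathcomp Require Export all_boot all_order all_algebra.
From mathcomp Require Import boolp.

Set Implicit Arguments.
Unset Strict Implicit.
Unset Printing Implicit Defensive.

Import GRing.Theory.
Local Open Scope ring_scope.

Record ltmx (R : nzRingType) := LTMx {
  ltmx_entry :> nat -> nat -> R;
  ltmx_entry0 : forall i j, (i < j)%N -> ltmx_entry i j = 0
}.
Arguments ltmx_entry : simpl never.

HB.instance Definition _ (R : nzRingType) := gen_eqMixin (ltmx R).
HB.instance Definition _ (R : nzRingType) := gen_choiceMixin (ltmx R).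

Section LtmxRing.
Variable R : nzRingType.
Implicit Types (A B C : ltmx R) (E : nat -> nat -> R).

Lemma ltmxP A B : (forall i j, A i j = B i j) -> A = B.
Proof.
case: A B => [f f0] [g g0] /= fg.
have efg : f = g by apply/funext => i; apply/funext => j; exact: fg.
by subst g; congr LTMx; exact: Prop_irrelevance.
Qed.

Fact ltmx_of_subproof E i j :
  (i < j)%N -> (if (j <= i)%N then E i j else 0) = 0.
Proof. by rewrite ltnNge => /negbTE ->. Qed.

Definition ltmx_of E : ltmx R :=
  LTMx (fun i j => @ltmx_of_subproof E i j).

Definition ltmx_zero : ltmx R := ltmx_of (fun _ _ => 0).
Definition ltmx_opp A : ltmx R := ltmx_of (fun i j => - A i j).
Definition ltmx_add A B : ltmx R := ltmx_of (fun i j => A i j + B i j).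
Definition ltmx_one : ltmx R := ltmx_of (fun i j => (i == j)%:R).
(* The terms of index k > i vanish, since then A i k = 0. *)
Definition ltmx_mul A B : ltmx R :=
  ltmx_of (fun i j => \sum_(k < i.+1) A i k * B k j).

Lemma ltmx_ofE E i j : (j <= i)%N -> ltmx_of E i j = E i j.
Proof. by rewrite /ltmx_of /ltmx_entry => ->. Qed.

Lemma ltmx_of_full E i j :
  ((i < j)%N -> E i j = 0) -> ltmx_of E i j = E i j.
Proof. by rewrite /ltmx_of /ltmx_entry => E0; case: leqP => // /E0. Qed.

Lemma ltmx_oppE A i j : ltmx_opp A i j = - A i j.
Proof. by apply: ltmx_of_full => /ltmx_entry0 ->; rewrite oppr0. Qed.

Lemma ltmx_addE A B i j : ltmx_add A B i j = A i j + B i j.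
Proof.
by apply: ltmx_of_full => ij; rewrite !ltmx_entry0 // addr0.
Qed.

Lemma ltmx_zeroE i j : ltmx_zero i j = 0.
Proof. exact: ltmx_of_full. Qed.

Lemma ltmx_oneE i j : ltmx_one i j = (i == j)%:R.
Proof. by apply: ltmx_of_full => ij; rewrite ltn_eqF. Qed.

Lemma ltmx_mulE n A B i j :
  (i < n)%N -> ltmx_mul A B i j = \sum_(k < n) A i k * B k j.
Proof.
move=> lt_in; rewrite ltmx_of_full => [|ij]; last first.
  apply: big1 => k _; rewrite [B k j]ltmx_entry0 ?mulr0 //.
  by rewrite (leq_ltn_trans _ ij) // -ltnS.
rewrite (big_ord_widen _ (fun k => A i k * B k j) lt_in) big_mkcond /=.
apply: eq_bigr => k _; case: ifPn => //.
by rewrite -leqNgt => ik; rewrite ltmx_entry0 ?mul0r.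
Qed.

Fact ltmx_addA : associative ltmx_add.
Proof. by move=> A B C; apply: ltmxP => i j; rewrite !ltmx_addE addrA. Qed.
Fact ltmx_addC : commutative ltmx_add.
Proof. by move=> A B; apply: ltmxP => i j; rewrite !ltmx_addE addrC. Qed.
Fact ltmx_add0 : left_id ltmx_zero ltmx_add.
Proof.
by move=> A; apply: ltmxP => i j; rewrite ltmx_addE ltmx_zeroE add0r.
Qed.
Fact ltmx_addN : left_inverse ltmx_zero ltmx_opp ltmx_add.
Proof.
by move=> A; apply: ltmxP => i j; rewrite ltmx_addE ltmx_oppE ltmx_zeroE addNr.
Qed.

HB.instance Definition _ := GRing.isZmodule.Build (ltmx R)
  ltmx_addA ltmx_addC ltmx_add0 ltmx_addN.

Fact ltmx_mulA : associative ltmx_mul.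
Proof.
move=> A B C; apply: ltmxP => i j; rewrite !(@ltmx_mulE i.+1) //.
under eq_bigr => k _ do rewrite (@ltmx_mulE i.+1) // mulr_sumr.
under [RHS]eq_bigr => l _ do rewrite (@ltmx_mulE i.+1) // mulr_suml.
rewrite exchange_big /=; apply: eq_bigr => l _; apply: eq_bigr => k _.
exact: mulrA.
Qed.

Fact ltmx_mul1l : left_id ltmx_one ltmx_mul.
Proof.
move=> A; apply: ltmxP => i j; rewrite (@ltmx_mulE i.+1) //.
rewrite (bigD1 (Ordinal (ltnSn i))) //= ltmx_oneE eqxx mul1r.
rewrite big1 ?addr0 // => k; rewrite -val_eqE /= => ki.
by rewrite ltmx_oneE eq_sym (negbTE ki) mul0r.
Qed.

Fact ltmx_mul1r : right_id ltmx_one ltmx_mul.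
Proof.
move=> A; apply: ltmxP => i j.
have ltj : (j < (i + j).+1)%N by rewrite ltnS leq_addl.
rewrite (@ltmx_mulE (i + j).+1) ?ltnS ?leq_addr //.
rewrite (bigD1 (Ordinal ltj)) //= ltmx_oneE eqxx mulr1.
rewrite big1 ?addr0 // => k; rewrite -val_eqE /= => kj.
by rewrite ltmx_oneE (negbTE kj) mulr0.
Qed.

Fact ltmx_mulDl : left_distributive ltmx_mul ltmx_add.
Proof.
move=> A B C; apply: ltmxP => i j; rewrite ltmx_addE !(@ltmx_mulE i.+1) //.
by rewrite -big_split; apply: eq_bigr => k _; rewrite ltmx_addE mulrDl.
Qed.

Fact ltmx_mulDr : right_distributive ltmx_mul ltmx_add.
Proof.
move=> A B C; apply: ltmxP => i j; rewrite ltmx_addE !(@ltmx_mulE i.+1) //.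
by rewrite -big_split; apply: eq_bigr => k _; rewrite ltmx_addE mulrDr.
Qed.

Fact ltmx_one_neq0 : ltmx_one != 0 :> ltmx R.
Proof.
apply/eqP => /(congr1 (fun A : ltmx R => A 0%N 0%N)).
by rewrite ltmx_oneE ltmx_zeroE; apply/eqP; exact: oner_neq0.
Qed.

HB.instance Definition _ := GRing.Zmodule_isNzRing.Build (ltmx R)
  ltmx_mulA ltmx_mul1l ltmx_mul1r ltmx_mulDl ltmx_mulDr ltmx_one_neq0.

Definition ltmx_inverses A B := B * A = 1 /\ A * B = 1.

Definition ltmx_unit : pred (ltmx R) := fun A => `[< exists B, ltmx_inverses A B >].

(* As required of a unitRingType, the inverse of a non-unit is itself. *)
Definition ltmx_inv A : ltmx R :=
  if pselect (exists B, ltmx_inverses A B) is left e then projT1 (cid e) else A.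

Lemma ltmx_invP A : A \in ltmx_unit -> ltmx_inverses A (ltmx_inv A).
Proof.
move=> /asboolP uA; rewrite /ltmx_inv; case: pselect => // e.
exact: (projT2 (cid e)).
Qed.

Fact ltmx_mulVr : {in ltmx_unit, left_inverse 1 ltmx_inv *%R}.
Proof. by move=> A /ltmx_invP[]. Qed.
Fact ltmx_mulrV : {in ltmx_unit, right_inverse 1 ltmx_inv *%R}.
Proof. by move=> A /ltmx_invP[]. Qed.
Fact ltmx_unitP A B : B * A = 1 /\ A * B = 1 -> ltmx_unit A.
Proof. by move=> AB; apply/asboolP; exists B. Qed.
Fact ltmx_inv_out : {in [predC ltmx_unit], ltmx_inv =1 id}.
Proof.
move=> A; rewrite inE /= => nuA; rewrite /ltmx_inv; case: pselect => // e.
by case/negP: nuA; apply/asboolP.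
Qed.

HB.instance Definition _ := GRing.NzRing_hasMulInverse.Build (ltmx R)
  ltmx_mulVr ltmx_mulrV ltmx_unitP ltmx_inv_out.

Lemma mulltmxE n A B i j :
  (i < n)%N -> (A * B) i j = \sum_(k < n) A i k * B k j.
Proof. exact: ltmx_mulE. Qed.

Lemma oneltmxE i j : (1 : ltmx R) i j = (i == j)%:R.
Proof. exact: ltmx_oneE. Qed.

(* Forward substitution: column j of the right inverse. *)
Fixpoint fsubst_seq A (j n : nat) : seq R :=
  if n is m.+1 then
    let s := fsubst_seq A j m in
    rcons s ((m == j)%:R - \sum_(k < m) A m k * s`_k)
  else [::].

Definition fsubst A j i : R := (fsubst_seq A j i.+1)`_i.

Lemma size_fsubst_seq A j n : size (fsubst_seq A j n) = n.
Proof. by elim: n => //= n IHn; rewrite size_rcons IHn. Qed.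

Lemma nth_fsubst_seq A j n k : (k < n)%N -> (fsubst_seq A j n)`_k = fsubst A j k.
Proof.
elim: n => // n IHn; rewrite ltnS leq_eqVlt => /predU1P[-> // | kn].
by rewrite /= nth_rcons size_fsubst_seq kn IHn.
Qed.

Lemma fsubstE A j i :
  fsubst A j i = (i == j)%:R - \sum_(k < i) A i k * fsubst A j k.
Proof.
rewrite {1}/fsubst /= nth_rcons size_fsubst_seq ltnn eqxx.
by congr (_ - _); apply: eq_bigr => k _; rewrite nth_fsubst_seq.
Qed.

Lemma fsubst0 A j i : (i < j)%N -> fsubst A j i = 0.
Proof.
elim/ltn_ind: i => i IHi ij; rewrite fsubstE ltn_eqF // big1 ?subr0 // => k _.
by rewrite IHi ?mulr0 // (ltn_trans _ ij).
Qed.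

Lemma unitriangular_rinv A : (forall i, A i i = 1) ->
  exists2 B : ltmx R, (forall i, B i i = 1) & A * B = 1.
Proof.
move=> A1; exists (ltmx_of (fun i j => fsubst A j i)) => [i|].
  rewrite ltmx_ofE // fsubstE eqxx big1 ?subr0 // => k _.
  by rewrite fsubst0 ?mulr0.
apply: ltmxP => i j; rewrite (@mulltmxE i.+1) // oneltmxE.
under eq_bigr => k _ do rewrite (ltmx_of_full (@fsubst0 A j k)).
by rewrite big_ord_recr /= A1 mul1r fsubstE addrC subrK.
Qed.

Lemma unitriangular_unit A : (forall i, A i i = 1) -> A \is a GRing.unit.
Proof.
move=> /unitriangular_rinv[B /unitriangular_rinv[C _ BC] AB].
apply/unitrP; exists B; split=> //.
by rewrite -[A]mulr1 -BC mulrA AB mul1r.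
Qed.

End LtmxRing.

Definition bit (n k : nat) : bool := odd (n %/ 2 ^ k).

Definition free_of (i j : nat) : bool := `[< forall k, bit j k -> ~~ bit i k >].

(* The bits of n in positions k >= n are 0, since n < 2 ^ n. *)
Definition bitsum (n : nat) : nat := (\sum_(k < n) bit n k)%N.

Definition Smx (R : nzRingType) : ltmx R :=
  ltmx_of (fun i j => ('C(i, j) %% 2)%:R).

(* x ^+ 0 = 1 for every x, including x = 0. *)
Definition Sx (R : nzRingType) (x : R) : ltmx R :=
  ltmx_of (fun i j => if free_of (i - j) j then x ^+ bitsum (i - j) else 0).

Lemma Smx_unit (R : nzRingType) : Smx R \is a GRing.unit.
Proof. by apply: unitriangular_unit => i; rewrite ltmx_ofE // binn. Qed.

(* Main.v *)
(* Splitting off the last binary digit of both indices presents S(x) as a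
   self-similar matrix: the block of S(x) at (i, j) is S(x)_ij times the 2 x 2
   matrix [[1, 0], [x, 1]], and this recursion, with S(x)_00 = 1, determines
   S(x).  Since [[1, 0], [x, 1]] [[1, 0], [y, 1]] = [[1, 0], [x + y, 1]], the
   product S(x) S(y) satisfies the recursion of S(x + y).  The identity matrix
   satisfies that of S(0), and S that of S(1) by Lucas' theorem modulo 2.  So
   x |-> S(x) is a homomorphism from the additive group with S(1) = S. *)
Require Import Defs.
From mathcomp Require Import boolp zify.

Import GRing.Theory.
Local Open Scope ring_scope.

Lemma bit_double0 (b : bool) n : bit (b + n.*2) 0 = b.
Proof. by rewrite /bit divn1 oddD odd_double addbF oddb. Qed.

Lemma bit_doubleS (b : bool) n k : bit (b + n.*2) k.+1 = bit n k.
Proof.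
by rewrite /bit expnS divnMA divn2 halfD odd_double andbF doubleK; case: b.
Qed.

Lemma bit_out n k : (n <= k)%N -> bit n k = false.
Proof.
move=> nk.
have /divn_small : (n < 2 ^ k)%N by apply: leq_ltn_trans nk (ltn_expl _ _).
by rewrite /bit => ->.
Qed.

(** Extra zero digits let digit sums of different numbers be compared over a common range of
    positions. *)
Lemma bitsum_widen n m : (n <= m)%N -> (\sum_(k < m) bit n k)%N = bitsum n.
Proof.
move=> nm; rewrite /bitsum (big_ord_widen _ (fun k => bit n k : nat) nm).
rewrite [RHS]big_mkcond; apply: eq_bigr => k _.
by case: ltnP => // /bit_out ->.
Qed.

Lemma bitsum_double (b : bool) n : bitsum (b + n.*2) = (b + bitsum n)%N.
Proof.
(* Removing position 0 from a range of length [n.*2.+1] leaves [n.*2] positions, enough for [n]. *)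
have le_n : (b + n.*2 <= n.*2.+1)%N by case: b.
rewrite -(bitsum_widen _ _ le_n) big_ord_recl bit_double0.
have le_nn : (n <= n.*2)%N by lia.
rewrite -(bitsum_widen _ _ le_nn); congr addn.
by apply: eq_bigr => k _; rewrite lift0 bit_doubleS.
Qed.

Lemma free_of_double (a b : bool) i j :
  free_of (a + i.*2) (b + j.*2) = ~~ (a && b) && free_of i j.
Proof.
apply/asboolP/andP => [fr|[ab /asboolP fr] [|k]].
- split; last by apply/asboolP => k; have := fr k.+1; rewrite !bit_doubleS.
  by have := fr 0%N; rewrite !bit_double0; case: a b {fr} => -[] //; apply.
- by rewrite !bit_double0; case: a b ab => -[].
- by rewrite !bit_doubleS; exact: fr.
Qed.

(** Pascal's rule applied twice produces ['C(n, m.+1)] twice, and the two copies cancel modulo 2. *)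
Lemma odd_binSS n m :
  odd 'C(n.+2, m.+2) = odd 'C(n, m.+2) (+) odd 'C(n, m).
Proof. by rewrite !binS !oddD; do 3 case: odd. Qed.

(** These are the coefficients in (1 + X)^(2n) = (1 + X^2)^n modulo 2. *)
Lemma odd_bin_double n m :
  odd 'C(n.*2, m.*2) = odd 'C(n, m) /\ odd 'C(n.*2, m.*2.+1) = false.
Proof.
elim: n m => [|n IHn] [|m]; rewrite ?bin0 ?bin0n ?bin1 ?odd_double //.
have [E1 O1] := IHn m; have [E2 O2] := IHn m.+1; rewrite !doubleS in E2 O2 *.
by rewrite !odd_binSS E1 O1 E2 O2 binS oddD.
Qed.

Lemma odd_bin_digit (a b : bool) n m :
  odd 'C(a + n.*2, b + m.*2) = odd 'C(n, m) && (b ==> a).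
Proof.
have [E O] := odd_bin_double n m.
case: a b => -[]; rewrite ?add0n ?add1n ?andbT ?andbF //.
  by rewrite binS oddD E O.
case: m E {O} => [|m] E; first by rewrite !bin0.
by rewrite doubleS binS oddD -doubleS E (odd_bin_double n m).2 addbF.
Qed.

Section SelfSimilar.
Variable R : comNzRingType.
Implicit Types (A : ltmx R) (x y : R).

Definition block x (a b : bool) : R :=
  if a == b then 1 else if a then x else 0.

Definition self_similar x A := A 0%N 0%N = 1 /\
  forall (a b : bool) i j, A (a + i.*2)%N (b + j.*2)%N = A i j * block x a b.

(** Halving both indices lowers any positive row index; row 0 is fixed by its corner entry and
    triangularity. *)
Lemma self_similar_unique x A B :
  self_similar x A -> self_similar x B -> A = B.
Proof.
move=> [A00 AE] [B00 BE]; apply: ltmxP => i.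
elim/ltn_ind: i => -[_ [|j]|i IHi j]; first by rewrite A00 B00.
  by rewrite !ltmx_entry0.
rewrite -[i.+1]odd_double_half -[j]odd_double_half AE BE IHi //; lia.
Qed.

Lemma SxE x i j :
  Sx x i j = if (j <= i)%N && free_of (i - j) j then x ^+ bitsum (i - j) else 0.
Proof.
case: (leqP j i) => ij; last by rewrite ltmx_entry0.
by rewrite ltmx_ofE.
Qed.

Lemma Sx_self_similar x : self_similar x (Sx x).
Proof.
split=> [|a b i j].
  have fr00 : free_of 0 0 by apply/asboolP => k; rewrite bit_out.
  by rewrite SxE /= subn0 fr00 /bitsum big_ord0.
rewrite !SxE.
have [ab|ba] := boolP (b ==> a); last first.
  have [-> ->] : a = false /\ b = true by case: a b ba => -[].
  rewrite /block /= mulr0; case: leqP => //= ji.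
  (* The subtraction borrows, so the difference is odd and meets the last digit 1 of the column
     index. *)
  have -> : (0 + i.*2 - (1 + j.*2) = true + (i - j.+1).*2)%N by lia.
  by rewrite (free_of_double true true).
have -> : (b + j.*2 <= a + i.*2)%N = (j <= i)%N by case: a b ab => -[] //=; lia.
case: leqP => ji /=; last by rewrite mul0r.
(* Without a borrow the last digits subtract on their own, and their difference cannot clash with
   [b]. *)
have -> : (a + i.*2 - (b + j.*2) = (a && ~~ b) + (i - j).*2)%N.
  by case: a b ab => -[] //=; lia.
rewrite free_of_double bitsum_double -andbA andNb andbF /=.
case: ifP => _; last by rewrite mul0r.
by rewrite exprD mulrC /block; case: a b ab => -[].
Qed.

Lemma one_self_similar : self_similar 0 (1 : ltmx R).
Proof.
split=> [|a b i j]; rewrite !oneltmxE // /block.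
have -> : (a + i.*2 == b + j.*2)%N = (i == j) && (a == b).
  by case: a b => -[] /=; lia.
by case: (a == b); rewrite ?andbT ?mulr1 // andbF; case: a; rewrite mulr0.
Qed.

Lemma sum_double n (F : nat -> R) :
  \sum_(k < n.*2) F k = \sum_(k < n) (F k.*2 + F k.*2.+1).
Proof.
elim: n => [|n IHn]; first by rewrite !big_ord0.
by rewrite doubleS !big_ord_recr /= IHn addrA.
Qed.

Lemma mul_self_similar x y A B :
  self_similar x A -> self_similar y B -> self_similar (x + y) (A * B).
Proof.
move=> [A00 AE] [B00 BE]; split=> [|a b i j].
  by rewrite (@mulltmxE _ 1) // big_ord1 A00 B00 mulr1.
(* An even bound pairs the summation indices [k.*2] and [k.*2.+1]; each pair yields a product of two
   2 x 2 blocks. *)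
rewrite (@mulltmxE _ i.+1.*2); last by case: a; lia.
rewrite (@mulltmxE _ i.+1) // (sum_double _ (fun k => A _ k * B k _)) mulr_suml.
apply: eq_bigr => k _.
rewrite (AE a false i k) (AE a true i k) (BE false b k j) (BE true b k j).
rewrite ![_ * block _ _ _ * _]mulrACA -mulrDr; congr (_ * _).
by case: a b => -[]; rewrite /block /= ?(mulr1, mul1r, mulr0, mul0r, addr0, add0r).
Qed.

Lemma Smx_self_similar : self_similar 1 (Smx R).
Proof.
have SmxE i j : Smx R i j = (odd 'C(i, j))%:R.
  by rewrite ltmx_of_full ?modn2 // => ij; rewrite bin_small.
split=> [|a b i j]; rewrite !SmxE ?bin0 // odd_bin_digit /block.
by case: a b => -[] /=; rewrite ?andbT ?andbF ?mulr1 ?mulr0.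
Qed.

Lemma Sx0 : Sx (0 : R) = 1.
Proof. exact: self_similar_unique (Sx_self_similar 0) one_self_similar. Qed.

Lemma Sx1 : Sx (1 : R) = Smx R.
Proof. exact: self_similar_unique (Sx_self_similar 1) Smx_self_similar. Qed.

Lemma SxD x y : Sx (x + y) = Sx x * Sx y.
Proof.
apply: self_similar_unique (Sx_self_similar _) _.
exact: mul_self_similar (Sx_self_similar x) (Sx_self_similar y).
Qed.

Lemma SxMn x n : Sx (x *+ n) = Sx x ^+ n.
Proof. by elim: n => [|n IHn]; rewrite ?Sx0 // mulrS SxD IHn exprS. Qed.

Lemma SxN x : Sx (- x) = (Sx x)^-1.
Proof.
have VS : Sx (- x) * Sx x = 1 by rewrite -SxD addNr Sx0.
have SV : Sx x * Sx (- x) = 1 by rewrite -SxD subrr Sx0.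
have uS : Sx x \is a GRing.unit by apply/unitrP; exists (Sx (- x)).
(* The inverse of [ltmx] comes from choice, so it is identified by cancelling a unit. *)
by apply: (mulIr uS); rewrite VS mulVr.
Qed.

Lemma Sx_int (p : int) : Sx (p%:~R : R) = Smx R ^ p.
Proof.
case: p => n; first by rewrite SxMn Sx1.
by rewrite NegzE mulrNz SxN -exprnN SxMn Sx1.
Qed.

End SelfSimilar.

Theorem theorem4 :
  (forall (r : rat) (p : int) (q : nat),
     (0 < q)%N -> r = p%:~R / q%:R -> Sx r ^+ q = Smx rat ^ p)
  /\ (Smx rat)^-1 = Sx (-1)
  /\ Smx rat ^ 0 = 1
  /\ 1 = Sx (0 : rat).
Proof.
split=> [r p q q0 ->|].
  (* The [q]-th power of S(p/q) is S(q * (p/q)) = S(p). *)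
  rewrite -SxMn -[_ / _ *+ _]mulr_natr divfK ?Sx_int //.
  by rewrite Num.Theory.pnatr_eq0 -lt0n.
by rewrite SxN Sx1 Sx0 expr0z.
Qed.
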